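(* Let $N_1(n,k)$ be the number of $n$-bit partial Boolean functions that depend on $k$ bits and have exact quantum query complexity $1$ (i.e. are non-constant and can be computed exactly by a quantum 1-query algorithm). If $n\ge3$ and $k\ge2$, then $$N_1(n,k)\le n^2\,2^{2^{n-1}(1+2^{2-k})+2n^2}.$$
   Context: An $n$-bit partial Boolean function is a map $f:D\to\{0,1\}$ with $D\subseteq\{0,1\}^n$ (equivalently a string in $\{0,1,*\}^{2^n}$). $f$ depends on $k$ bits if $k$ is the minimum, over all multilinear polynomials $p$ with $p(x)=f(x)$ for all $x\in D$, of the number of variables occurring in $p$. A quantum 1-query algorithm works in a finite-dimensional Hilbert space with orthonormal basis $\{|i,j'\rangle\}$, $i\in\{0,\dots,n\}$; the oracle is $O_x|i,j'\rangle=(-1)^{x_i}|i,j'\rangle$ for $i\ge1$, $O_x|0,j'\rangle=|0,j'\rangle$; the algorithm applies input-independent unitaries $U_0,O_x,U_1$ to an initial state and performs a projective measurement with outcomes in $\{0,1\}$; it computes $f$ exactly if for every $x\in D$ the outcome is $f(x)$ with probability 1. *)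

(* Defs.v *)
From HB Require Import structures.
From mathcomp Require Import all_boot all_order all_algebra.
From mathcomp Require Import complex mxtens.
From mathcomp Require Import Rstruct.
From Stdlib Require Reals.
Notation Rpow := Rpower.Rpower.
Set Implicit Arguments. Unset Strict Implicit. Unset Printing Implicit Defensive.
Import Order.TTheory GRing.Theory Num.Theory.
Local Open Scope ring_scope.

Notation RR := Rdefinitions.R.
Notation CC := (RR[i]).

(** n-bit partial Boolean functions: a map {0,1}^n -> {0,1,*};
    [Some b] is the value b, [None] means "x is outside the domain D". *)
Definition pfun (n : nat) := {ffun {ffun 'I_n -> bool} -> option bool}.

(** A real multilinear polynomial in x_0..x_{n-1}: coefficient [c T] of the
    monomial prod_{i in T} x_i. *)
Definition mlpoly (n : nat) := {ffun {set 'I_n} -> RR}.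

Definition mleval n (c : mlpoly n) (x : {ffun 'I_n -> bool}) : RR :=
  \sum_(T : {set 'I_n}) c T * \prod_(i in T) (x i)%:R.

Definition represents n (c : mlpoly n) (f : pfun n) : Prop :=
  forall x b, f x = Some b -> mleval c x = b%:R.

Definition vars n (c : mlpoly n) : {set 'I_n} :=
  \bigcup_(T : {set 'I_n} | c T != 0) T.

Definition depends_on_bits n (f : pfun n) (k : nat) : Prop :=
  (exists c : mlpoly n, represents c f /\ #|vars c| = k) /\
  (forall c : mlpoly n, represents c f -> (k <= #|vars c|)%N).

Definition adj d1 d2 (A : 'M[CC]_(d1, d2)) : 'M[CC]_(d2, d1) :=
  (map_mx Num.conj A)^T.
Definition unitary d (U : 'M[CC]_d) : Prop := adj U *m U = 1%:M.
Definition orth_proj d (P : 'M[CC]_d) : Prop := adj P = P /\ P *m P = P.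

Definition sqnorm d (v : 'cV[CC]_d) : CC := \sum_(i < d) `|v i ord0| ^+ 2.

(** The oracle on the space with basis |i,j'>, i in {0..n}, j' in {0..m-1}
    (ordered as C^{n+1} (x) C^m): O_x|0,j'> = |0,j'>,
    O_x|i,j'> = (-1)^{x_i}|i,j'> for i >= 1 (x_i is stored at index i-1). *)
Definition oracle_sign n (x : {ffun 'I_n -> bool}) (i : 'I_n.+1) : CC :=
  if unlift ord0 i is Some j then (-1) ^+ x j else 1.
Definition oracle n m (x : {ffun 'I_n -> bool}) : 'M[CC]_(n.+1 * m) :=
  tensmx (diag_mx (\row_i oracle_sign x i)) (1%:M : 'M[CC]_m).

Definition exact_1query n (f : pfun n) : Prop :=
  exists (m : nat) (psi : 'cV[CC]_(n.+1 * m)) (U0 U1 P0 P1 : 'M[CC]_(n.+1 * m)),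
    [/\ sqnorm psi = 1, unitary U0, unitary U1,
        orth_proj P0 /\ orth_proj P1 /\ P0 + P1 = 1%:M &
        forall x b, f x = Some b ->
          sqnorm ((if b then P1 else P0) *m (U1 *m (oracle m x *m (U0 *m psi)))) = 1].

Definition nonconstant n (f : pfun n) : Prop :=
  exists x y, f x = Some false /\ f y = Some true.

Definition QE1 n (f : pfun n) : Prop := nonconstant f /\ exact_1query f.

(* Main.v *)
Require Import Defs.
From HB Require Import structures.
From mathcomp Require Import all_boot all_order all_algebra.
From mathcomp Require Import complex mxtens.
From mathcomp Require Import Rstruct.
From mathcomp Require Import zify.
Import Order.TTheory GRing.Theory Num.Theory.
Local Open Scope ring_scope.

(** Feed the oracle an arbitrary vector [z] in place of the signs
    [(1, (-1)^x_1, ..., (-1)^x_n)]: the two components of the final state cut out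
    by the measurement are linear in [z].  Hence the span [W0] of the sign vectors
    of [f^-1(0)] is killed by the accepting component, and the span [W1] of those
    of [f^-1(1)] by the rejecting one, so [W0] and [W1] meet inside the set of [z]
    vanishing at every query index of nonzero amplitude.  There are at least [k]
    such indices, since they determine [f] on its domain; therefore
    [dim W0 + dim W1 <= 2(n+1) - k], while both dimensions are at most [n].
    A subspace of dimension [d] contains at most [2^(d-1)] sign vectors with first
    entry 1, so convexity bounds the number of inputs in [W0] or [W1] by
    [2^(n-1) + 2^(n+1-k)].  Finally [f] is determined by [n] sign vectors spanning
    [W0], [n] spanning [W1], and its domain inside [W0] and [W1]. *)

(** * Rank bounds over a field *)

(** Some [\rank A] columns of [A] span its column space, and a vector of the row space is determined
    by its entries there; restricting [y] to these positions is thus injective. *)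
Lemma card_bool_rows_sub {F : fieldType} {m N : nat} (s : bool -> F)
    (A : 'M[F]_(m, N)) :
  injective s ->
  (#|[set y : {ffun 'I_N -> bool} | (\row_j s (y j) <= A)%MS]|
     <= 2 ^ \rank A)%N.
Proof.
move=> s_inj; set E := [set y | _].
pose g := maxrankfun A^T.
pose restr (y : {ffun 'I_N -> bool}) := [ffun i => y (g i)].
have -> : (2 ^ \rank A = #|{ffun 'I_(\rank A^T) -> bool}|)%N.
  by rewrite card_ffun card_bool card_ord mxrank_tr.
rewrite -(@card_in_imset _ _ restr E) ?max_card //.
move=> y1 y2; rewrite !inE => /submxP[u1 def1] /submxP[u2 def2] eq12.
have eq_sub : (u1 - u2) *m (rowsub g A^T)^T = 0.
  rewrite mulmxBl; apply/eqP; rewrite subr_eq0; apply/eqP/rowP=> i.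
  have part u (y : {ffun 'I_N -> bool}) : \row_j s (y j) = u *m A ->
      (u *m (rowsub g A^T)^T) 0 i = s (y (g i)).
    move/rowP/(_ (g i)); rewrite !mxE => ->.
    by apply: eq_bigr => j _; rewrite !mxE.
  rewrite (part _ _ def1) (part _ _ def2).
  by move/ffunP/(_ i): eq12; rewrite !ffunE => ->.
have eqA : (u1 - u2) *m A = 0.
  have /submxP[C defA] : (A^T <= rowsub g A^T)%MS by rewrite eq_maxrowsub.
  by rewrite -[A]trmxK defA trmx_mul mulmxA eq_sub mul0mx.
apply/ffunP => j; apply: s_inj.
move/eqP: eqA; rewrite mulmxBl -def1 -def2 subr_eq0 => /eqP/rowP/(_ j).
by rewrite !mxE.
Qed.

Lemma rank_zero_columns {F : fieldType} {m N : nat} (A : 'M[F]_(m, N))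
    (K : {set 'I_N}) :
  (forall i j, j \in K -> A i j = 0) -> (\rank A + #|K| <= N)%N.
Proof.
move=> A0; rewrite -[X in (_ <= X)%N](card_ord N) -(cardsC K) addnC leq_add2l.
pose ev (l : 'I_#|~: K|) : 'I_N := enum_val l.
(* [A] factors through its columns outside [K]; the second factor puts the zero columns back. *)
have -> : A = colsub ev A *m rowsub ev 1%:M.
  apply/matrixP => i j; rewrite !mxE.
  have [jK | jK] := boolP (j \in K).
    rewrite A0 // big1 // => l _; rewrite !mxE.
    case: eqP => [eq_j|]; last by rewrite mulr0.
    by have := enum_valP l; rewrite inE -/(ev l) eq_j jK.
  have jC : j \in ~: K by rewrite inE.
  rewrite (bigD1 (enum_rank_in jC j)) //= !mxE /ev enum_rankK_in // eqxx mulr1.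
  rewrite big1 ?addr0 // => l ne_l; rewrite !mxE.
  case: eqP => [eq_j|]; last by rewrite mulr0.
  by case/eqP: ne_l; apply: enum_val_inj; rewrite enum_rankK_in.
by apply: leq_trans (mulmx_max_rank _ _) _.
Qed.

(** * Sign vectors and their spans *)

Definition sign_row n (x : {ffun 'I_n -> bool}) : 'rV[CC]_n.+1 :=
  \row_i oracle_sign x i.
Arguments sign_row {n} x.

Definition signs_in n m (A : 'M[CC]_(m, n.+1)) : {set {ffun 'I_n -> bool}} :=
  [set x | (sign_row x <= A)%MS].
Arguments signs_in {n m} A.

Lemma oracle_sign_neq0 n (x : {ffun 'I_n -> bool}) i : oracle_sign x i != 0.
Proof.
by rewrite /oracle_sign; case: unliftP => [j _|_]; rewrite ?signr_eq0 ?oner_neq0.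
Qed.

Lemma normr_oracle_sign n (x : {ffun 'I_n -> bool}) i : `|oracle_sign x i| = 1.
Proof.
rewrite /oracle_sign; case: unliftP => [j _|_]; last exact: normr1.
by rewrite normrX normrN normr1 expr1n.
Qed.

Lemma sign_inj : injective (fun b : bool => (-1) ^+ b : CC).
Proof.
have ne : (1 : CC) != -1 by rewrite eq_sym -subr_eq0 -opprD oppr_eq0 (pnatr_eq0 _ 2).
by move=> [] [] //= /eqP; rewrite ?expr1 ?expr0 1?[-1 == _]eq_sym (negbTE ne).
Qed.

(* The sign vectors with first entry -1 are the opposites of those with first
   entry 1, which gains a factor 2 over [card_bool_rows_sub]. *)
Lemma card_signs_in n m (A : 'M[CC]_(m, n.+1)) :
  (2 * #|signs_in A| <= 2 ^ \rank A)%N.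
Proof.
apply: leq_trans (card_bool_rows_sub _ A sign_inj).
pose ext (p : bool * {ffun 'I_n -> bool}) : {ffun 'I_n.+1 -> bool} :=
  [ffun i => if unlift ord0 i is Some j then p.1 (+) p.2 j else p.1].
have ext_inj : injective ext.
  move=> [b x] [c y] /ffunP E.
  have := E ord0; rewrite !ffunE unlift_none /= => eq_bc.
  congr (_, _) => //; apply/ffunP=> j.
  by have := E (lift ord0 j); rewrite !ffunE liftK /= eq_bc => /addbI.
rewrite -card_bool -cardsT -cardsX -(card_imset _ ext_inj).
apply/subset_leq_card/subsetP=> y /imsetP[[b x]].
rewrite !inE /= => xA ->.
suff -> : \row_j (-1) ^+ ext (b, x) j = (-1) ^+ b *: sign_row x :> 'rV[CC]_n.+1.
  by rewrite scalemx_sub.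
apply/rowP=> i; rewrite !mxE ffunE /oracle_sign.
by case: unliftP => [j _|_] /=; rewrite ?mulr1 // signr_addb.
Qed.

(** The length [r] is fixed in advance, so that spanning families form a finite type of known
    size. *)
Definition tuple_mx n r (u : {ffun 'I_r -> {ffun 'I_n -> bool}}) :
  'M[CC]_(r, n.+1) := \matrix_i sign_row (u i).
Arguments tuple_mx {n r} u.

Definition set_mx n (D : {set {ffun 'I_n -> bool}}) : 'M[CC]_(#|D|, n.+1) :=
  \matrix_(i < #|D|) sign_row (enum_val i).
Arguments set_mx {n} D.

Lemma sign_row_set_mx n (D : {set {ffun 'I_n -> bool}}) x :
  x \in D -> (sign_row x <= set_mx D)%MS.
Proof.
move=> xD; have := row_sub (enum_rank_in xD x) (set_mx D).
by rewrite rowK enum_rankK_in.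
Qed.

Lemma set_mx_tuple n r (D : {set {ffun 'I_n -> bool}}) :
  D != set0 -> (\rank (set_mx D) <= r)%N ->
  exists u : {ffun 'I_r -> {ffun 'I_n -> bool}}, (tuple_mx u :=: set_mx D)%MS.
Proof.
case/set0Pn=> x0 x0D le_r; set A := set_mx D.
(* Positions past the rank repeat [x0], which lies in [D], so the padding leaves the span
   unchanged. *)
pose u : {ffun 'I_r -> {ffun 'I_n -> bool}} := [ffun i : 'I_r =>
  if insub (val i) : option 'I_(\rank A) is Some j
  then enum_val (maxrankfun A j) else x0].
exists u; apply/eqmxP/andP; split.
  apply/row_subP => i; rewrite rowK ffunE; apply: sign_row_set_mx.
  by case: insub => [j|//]; apply: enum_valP.
rewrite -(eq_maxrowsub A); apply/row_subP => j.
have lt_j : (j < r)%N by apply: leq_trans le_r.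
have -> : row j (rowsub (maxrankfun A) A) = row (Ordinal lt_j) (tuple_mx u).
  by rewrite row_rowsub !rowK ffunE /= valK.
exact: row_sub.
Qed.

Lemma set_mx_mul0 n d (D : {set {ffun 'I_n -> bool}}) (L : 'M[CC]_(n.+1, d)) :
  (forall x, x \in D -> sign_row x *m L = 0) -> set_mx D *m L = 0.
Proof.
move=> DL; apply/row_matrixP=> i.
by rewrite row_mul rowK row0 DL // enum_valP.
Qed.

(** * Multilinear interpolation *)

(** Induction on [#|T|]: for [t] in [T], [g = g0 + x_t * (g1 - g0)], where [g0] and [g1] are [g]
    with [x_t] set to 0 and 1. *)
Lemma multilinear_interpolation n (T : {set 'I_n})
    (g : {ffun 'I_n -> bool} -> RR) :
  (forall x y : {ffun 'I_n -> bool}, {in T, x =1 y} -> g x = g y) ->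
  exists c : mlpoly n, vars c \subset T /\ mleval c =1 g.
Proof.
have [m] := ubnP #|T|; elim: m T g => // m IHm T g; rewrite ltnS => le_T gT.
have [T0 | [t tT]] := set_0Vmem T.
  rewrite {}T0 in gT *; pose x0 : {ffun 'I_n -> bool} := [ffun=> false].
  exists [ffun U => (U == set0)%:R * g x0]; split.
    apply/bigcupsP=> U; rewrite ffunE; have [->|_] := eqVneq U set0.
      by rewrite sub0set.
    by rewrite mul0r eqxx.
  move=> x; rewrite /mleval (bigD1 set0) //= ffunE eqxx mul1r big_set0 mulr1.
  rewrite big1 ?addr0 => [|U /negbTE neU]; last by rewrite ffunE neU !mul0r.
  by apply: gT => i; rewrite inE.
pose set_t b (x : {ffun 'I_n -> bool}) := [ffun i => if i == t then b else x i].
have lt_T' : (#|T :\ t| < m)%N by rewrite (cardsD1 t) tT in le_T.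
have set_t_eq b (x y : {ffun 'I_n -> bool}) :
    {in T :\ t, x =1 y} -> g (set_t b x) = g (set_t b y).
  move=> xy; apply: gT => i iT; rewrite !ffunE; case: eqP => // /eqP ne.
  by apply: xy; rewrite !inE ne.
have [c0 [v0 e0]] := IHm _ (fun x => g (set_t false x)) lt_T' (set_t_eq false).
have [|c1 [v1 e1]] := IHm _ (fun x => g (set_t true x) - g (set_t false x)) lt_T'.
  by move=> x y xy; congr (_ - _); apply: set_t_eq.
have vars0 (c : mlpoly n) (U : {set 'I_n}) :
    vars c \subset T :\ t -> t \in U -> c U = 0.
  move=> vc tU; apply/eqP/negPn/negP => cU.
  have /subsetP/(_ t) := elimT bigcupsP vc U cU.
  by rewrite tU !inE eqxx => /(_ isT).
(* Neither [c0] nor [c1] involves [t], so multiplying [c1] by [x_t] just shifts its monomials [U] to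
   [t |: U]. *)
exists [ffun U : {set 'I_n} => if t \in U then c1 (U :\ t) else c0 U]; split.
  apply/bigcupsP=> U; rewrite ffunE; case: ifP => tU cU.
    rewrite -(setD1K tU) subUset sub1set tT.
    by rewrite (subset_trans (elimT bigcupsP v1 _ cU)) ?subsetDl.
  by rewrite (subset_trans (elimT bigcupsP v0 _ cU)) ?subsetDl.
move=> x; transitivity (mleval c0 x + (x t)%:R * mleval c1 x); last first.
  rewrite e0 e1; case xt: (x t).
    rewrite mul1r addrC subrK; apply: gT => i _; rewrite ffunE.
    by case: eqP => // ->.
  rewrite mul0r addr0; apply: gT => i _; rewrite ffunE.
  by case: eqP => // ->.
rewrite /mleval (bigID (fun U : {set 'I_n} => t \in U)) /= addrC; congr (_ + _).
  rewrite [RHS](bigID (fun U : {set 'I_n} => t \in U)) /= [X in X + _]big1 ?add0r.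
    by apply: eq_bigr => U /negbTE tU; rewrite ffunE tU.
  by move=> U tU; rewrite vars0 ?mul0r.
rewrite [X in _ * X](bigID (fun U : {set 'I_n} => t \in U)) /=.
rewrite [X in X + _]big1 ?add0r; last first.
  by move=> U tU; rewrite vars0 ?mul0r.
rewrite (reindex_onto (fun U => t |: U) (fun U => U :\ t)) /=; last first.
  by move=> U tU; rewrite setD1K.
rewrite mulr_sumr; apply: eq_big => [U | U /andP[_ /eqP eU]].
  rewrite setU11 /=; apply/eqP/idP => [<-|tU]; first by rewrite !inE eqxx.
  by rewrite setU1K.
have tU : t \notin U by rewrite -eU !inE eqxx.
by rewrite ffunE setU11 eU big_setU1 //= mulrCA.
Qed.

(** * Exact one-query algorithms *)

Lemma sqnorm_adj d (v : 'cV[CC]_d) : sqnorm v = (adj v *m v) 0 0.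
Proof.
by rewrite mxE; apply: eq_bigr => i _; rewrite !mxE normCK mulrC.
Qed.

Lemma adj_mul m p q (A : 'M[CC]_(m, p)) (B : 'M[CC]_(p, q)) :
  adj (A *m B) = adj B *m adj A.
Proof. by rewrite /adj map_mxM trmx_mul. Qed.

Lemma sqnorm_unitary d (U : 'M[CC]_d) (v : 'cV[CC]_d) :
  unitary U -> sqnorm (U *m v) = sqnorm v.
Proof.
by move=> uU; rewrite !sqnorm_adj adj_mul mulmxA -(mulmxA _ (adj U)) uU mulmx1.
Qed.

Lemma sqnorm_eq0 d (v : 'cV[CC]_d) : sqnorm v = 0 -> v = 0.
Proof.
move/eqP; rewrite psumr_eq0 => [/allP v0|i _]; last exact: exprn_ge0.
apply/colP=> i; have := v0 i; rewrite mem_index_enum => /(_ isT).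
by rewrite expf_eq0 /= normr_eq0 mxE => /eqP.
Qed.

Lemma sqnorm_orth_proj d (P0 P1 : 'M[CC]_d) (v : 'cV[CC]_d) :
  orth_proj P0 -> orth_proj P1 -> P0 + P1 = 1%:M ->
  sqnorm (P0 *m v) + sqnorm (P1 *m v) = sqnorm v.
Proof.
move=> [a0 i0] [a1 i1] sum1.
have proj P : adj P = P -> P *m P = P ->
    sqnorm (P *m v) = (adj v *m (P *m v)) 0 0.
  by move=> aP iP; rewrite sqnorm_adj adj_mul aP mulmxA -(mulmxA (adj v)) iP mulmxA.
rewrite !proj // sqnorm_adj -[X in _ = (_ *m X) 0 0]mul1mx -sum1.
by rewrite mulmxDl mulmxDr [RHS]mxE.
Qed.

Lemma oracle_mulE n m (x : {ffun 'I_n -> bool}) (v : 'cV[CC]_(n.+1 * m)) l :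
  (oracle m x *m v) l 0 = oracle_sign x (mxtens_unindex l).1 * v l 0.
Proof.
rewrite mxE (bigD1 l) //= big1 ?addr0 => [|l' ne].
  by rewrite !mxE !eqxx mulr1n mulr1.
rewrite !mxE; case: (altP (_ =P (mxtens_unindex l').1)) => [e1|_]; last first.
  by rewrite mulr0n !mul0r.
case: (altP (_ =P (mxtens_unindex l').2)) => [e2|_]; last by rewrite mulr0 mul0r.
case/eqP: ne; apply: (can_inj (@mxtens_unindexK _ _)).
by rewrite (surjective_pairing (mxtens_unindex l')) -e1 -e2 -surjective_pairing.
Qed.

(* With signs as the unknown [z], the two post-measurement states are linear in
   [z]; [K] is the set of query indices carrying nonzero amplitude. *)
Lemma exact_1query_linear n (f : pfun n) :
  exact_1query f ->
  exists (K : {set 'I_n.+1}) (d : nat) (L0 L1 : 'M[CC]_(n.+1, d)),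
    [/\ K != set0,
        forall z : 'rV_n.+1, {in K, forall i, z 0 i = 0} ->
          z *m L0 = 0 /\ z *m L1 = 0,
        forall z : 'rV_n.+1, z *m (L0 + L1) = 0 -> {in K, forall i, z 0 i = 0} &
        forall x b, f x = Some b -> sign_row x *m (if b then L0 else L1) = 0].
Proof.
case=> m [psi [U0 [U1 [P0 [P1 [npsi uU0 uU1 [oP0 [oP1 sumP]] fP]]]]]].
set w := U0 *m psi in fP.
have nw : sqnorm w = 1 by rewrite sqnorm_unitary. clearbody w.
pose e (l : 'I_(n.+1 * m)) : 'I_n.+1 := (mxtens_unindex l).1.
(* [z *m L] is the state [w] after a diagonal oracle whose signs are replaced by the entries of
   [z]. *)
pose L : 'M[CC]_(n.+1, n.+1 * m) := \matrix_(i, l) ((i == e l)%:R * w l 0).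
have LE (z : 'rV_n.+1) l : (z *m L) 0 l = z 0 (e l) * w l 0.
  rewrite mxE (bigD1 (e l)) //= mxE eqxx mul1r big1 ?addr0 // => i ne.
  by rewrite mxE (negbTE ne) mul0r mulr0.
have oL x : oracle m x *m w = (sign_row x *m L)^T.
  by apply/colP=> l; rewrite oracle_mulE mxE LE mxE.
have nO x : sqnorm (oracle m x *m w) = 1.
  rewrite -nw; apply: eq_bigr => l _.
  by rewrite oracle_mulE normrM normr_oracle_sign mul1r.
pose K := [set e l | l in [pred l | w l 0 != 0]].
exists K, _, (L *m U1^T *m P0^T), (L *m U1^T *m P1^T); split.
- apply/set0Pn; suff /existsP[l wl]: [exists l, w l 0 != 0].
    by exists (e l); apply: imset_f; rewrite inE.
  rewrite -negb_forall; apply/negP => /forallP w0.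
  have := oner_neq0 CC; rewrite -nw /sqnorm big1 ?eqxx // => l _.
  by rewrite (eqP (w0 l)) normr0 expr0n.
- move=> z zK; suff zL : z *m L = 0 by rewrite !mulmxA zL !mul0mx.
  apply/rowP=> l; rewrite LE mxE; have [->|wl] := eqVneq (w l 0) 0.
    by rewrite mulr0.
  by rewrite zK ?mul0r // imset_f ?inE.
(* As [P0 + P1 = 1], the two components add up to [z *m L *m U1^T], and [U1^T] is invertible. *)
- move=> z; rewrite -mulmxDr -raddfD /= sumP trmx1 mulmx1 mulmxA => zU.
  have uU1' : U1^T *m (map_mx Num.conj U1) = 1%:M.
    by rewrite -[RHS]trmx1 -uU1 trmx_mul /adj trmxK.
  have zL : z *m L = 0 by rewrite -[z *m L]mulmx1 -uU1' mulmxA zU mul0mx.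
  move=> i /imsetP[l]; rewrite inE => wl ->.
  move/rowP/(_ l)/eqP: zL; rewrite LE mxE mulf_eq0 (negbTE wl) orbF.
  by move/eqP.
(* The correct outcome carries all of the squared norm 1, so the component of the other outcome
   vanishes. *)
move=> x b fx; have := fP x b fx; rewrite oL.
set v := U1 *m (sign_row x *m L)^T => Pv1.
have := sqnorm_orth_proj _ _ _ v oP0 oP1 sumP.
have -> : sqnorm v = 1 by rewrite sqnorm_unitary // -oL nO.
have tr P : P *m v = 0 -> sign_row x *m (L *m U1^T *m P^T) = 0.
  move=> Pv; apply: trmx_inj; rewrite trmx0 -[RHS]Pv !trmx_mul !trmxK.
  by rewrite -!mulmxA /v trmx_mul.
case: b fx Pv1 => _ ->.
  by rewrite -[RHS]add0r => /addIr/sqnorm_eq0/tr.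
by rewrite -[RHS]addr0 => /addrI/sqnorm_eq0/tr.
Qed.

(** * Dimension bounds and counting *)

(** By convexity, the sum is largest when the exponents are as far apart as allowed, at [c] and
    [s - c]. *)
Lemma expn_add_leq_spread a b c s :
  (a <= s - c -> b <= s - c -> c <= s -> a + b <= s ->
   2 ^ a + 2 ^ b <= 2 ^ (s - c) + 2 ^ c)%N.
Proof.
move=> a_le b_le cs ab.
have [ac|/ltnW ca] := leqP a c.
  by rewrite addnC leq_add ?leq_pexp2l.
have [bc|/ltnW cb] := leqP b c.
  by rewrite leq_add ?leq_pexp2l.
have le_ab : (2 ^ (a + b - c) <= 2 ^ (s - c))%N by rewrite leq_pexp2l ?leq_sub2r.
apply: leq_trans (leq_add le_ab (leqnn _)).
have -> : (a + b - c = c + (a - c) + (b - c))%N by lia.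
rewrite -{1}(subnKC ca) -{1}(subnKC cb) !expnD.
have: (0 < 2 ^ (a - c))%N by rewrite expn_gt0.
have: (0 < 2 ^ (b - c))%N by rewrite expn_gt0.
(* After division by [2 ^ c] this is [u + v <= u * v + 1] for [u, v >= 1], that is,
   [(u - 1) * (v - 1) >= 0]. *)
by case: (2 ^ (a - c))%N (2 ^ (b - c))%N => // A [] // B _ _; nia.
Qed.

Definition level n (f : pfun n) (b : bool) : {set {ffun 'I_n -> bool}} :=
  [set x | f x == Some b].
Arguments level {n} f b.

Lemma QE1_spans n k (f : pfun n) :
  depends_on_bits f k -> QE1 f ->
  [/\ (k <= n)%N,
      (\rank (set_mx (level f false)) <= n)%N,
      (\rank (set_mx (level f true)) <= n)%N,
      (\rank (set_mx (level f false)) + \rank (set_mx (level f true)) + k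
         <= 2 * n.+1)%N &
      [disjoint signs_in (set_mx (level f false))
         & signs_in (set_mx (level f true))]].
Proof.
move=> [[c0 [_ c0k]] min_k] [[x0 [x1 [fx0 fx1]]]].
case/exact_1query_linear=> K [d [L0 [L1 [K_neq0 LK KL fL]]]].
set A0 := set_mx _; set A1 := set_mx _.
have A0L : A0 *m L1 = 0.
  by apply: set_mx_mul0 => x; rewrite inE => /eqP/fL.
have A1L : A1 *m L0 = 0.
  by apply: set_mx_mul0 => x; rewrite inE => /eqP/fL.
have capL m (z : 'M_(m, n.+1)) : (z <= A0)%MS -> (z <= A1)%MS ->
    z *m (L0 + L1) = 0.
  move=> /submxP[a ->] /submxP[b e1].
  by rewrite mulmxDr -[_ *m L1]mulmxA A0L mulmx0 addr0 e1 -mulmxA A1L mulmx0.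
(* Signs are nonzero and [K] is nonempty, so no sign vector lies in both spans; each span is
   therefore proper. *)
have signL x : sign_row x *m (L0 + L1) = 0 -> False.
  move/KL => xK; case/set0Pn: K_neq0 => i /xK.
  by rewrite mxE => /eqP; rewrite (negbTE (oracle_sign_neq0 _ _ _)).
have ncap x : (sign_row x <= A0)%MS -> (sign_row x <= A1)%MS -> False.
  by move=> xA0 xA1; apply: (@signL x); apply: capL.
have rank_le m m' (A : 'M[CC]_(m, n.+1)) (B : 'M[CC]_(m', n.+1)) x :
    (sign_row x <= B)%MS ->
    ((sign_row x <= A)%MS -> (sign_row x <= B)%MS -> False) -> (\rank A <= n)%N.
  move=> xB nAB; rewrite -ltnS ltn_neqAle rank_leq_col andbT.
  by apply/negP => fullA; apply: nAB => //; apply: submx_full.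
have x0A : (sign_row x0 <= A0)%MS by apply: sign_row_set_mx; rewrite inE fx0.
have x1A : (sign_row x1 <= A1)%MS by apply: sign_row_set_mx; rewrite inE fx1.
have k_le_n : (k <= n)%N by rewrite -c0k -[X in (_ <= X)%N](card_ord n) max_card.
split=> //.
- by apply: rank_le x1A _ => *; apply: (@ncap x1).
- by apply: rank_le x0A _ => *; apply: (@ncap x0).
- have kK : (k <= #|K|)%N.
    (* Index 0 is dropped: its sign is always 1, so agreement on [T] already gives equal signs on
       all of [K]. *)
    pose T := [set j : 'I_n | lift ord0 j \in K].
    have le_TK : (#|T| <= #|K|)%N.
      rewrite -(card_imset _ (@lift_inj _ ord0)); apply/subset_leq_card.
      by apply/subsetP=> i /imsetP[j]; rewrite inE => jK ->.
    apply: leq_trans le_TK.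
    have agree (x y : {ffun 'I_n -> bool}) : {in T, x =1 y} ->
        forall i, i \in K -> (sign_row x - sign_row y) 0 i = 0.
      move=> xy i iK; rewrite !mxE /oracle_sign.
      case: unliftP iK => [j -> jK|_ _]; last by rewrite subrr.
      by rewrite xy ?subrr // inE.
    have f_agree (x y : {ffun 'I_n -> bool}) b :
        {in T, x =1 y} -> f x = Some true -> f y = Some b -> b.
      case: b => // /agree/LK[_]; rewrite mulmxBl => /eqP; rewrite subr_eq0.
      move=> /eqP xy1 /fL xL0 /fL yL1; exfalso; apply: (@signL x).
      by rewrite mulmxDr xL0 xy1 yL1 addr0.
    pose same (x y : {ffun 'I_n -> bool}) := [forall j in T, x j == y j].
    have sameP (x y : {ffun 'I_n -> bool}) : reflect {in T, x =1 y} (same x y).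
      by apply: (iffP forall_inP) => xy j /xy /eqP.
    (* A total extension of [f] depending only on the bits in [T]; interpolating it and using the
       minimality of [k] gives [k <= #|T|]. *)
    pose g y : RR := [exists x, (f x == Some true) && same x y]%:R.
    have [|c [vc gc]] := @multilinear_interpolation n T g.
      move=> x y xy; rewrite /g; congr (nat_of_bool _)%:R.
      apply: eq_existsb => z; congr (_ && _).
      by apply/sameP/sameP => zx j jT; rewrite zx ?xy.
    apply: leq_trans (subset_leq_card vc); apply: min_k => y b fy.
    rewrite gc /g; congr (nat_of_bool _)%:R.
    apply/existsP/idP => [[x /andP[/eqP fx /sameP xy]]|b1].
      exact: f_agree xy fx fy.
    by exists y; rewrite fy b1 eqxx; apply/sameP.
  have capK : (\rank (A0 :&: A1)%MS + #|K| <= n.+1)%N.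
    apply: rank_zero_columns => i j jK.
    have := @KL (row i (A0 :&: A1)%MS) _ j jK; rewrite mxE; apply.
    by apply: capL; apply: submx_trans (row_sub _ _) _; rewrite ?capmxSl ?capmxSr.
  have := mxrank_sum_cap A0 A1; have := rank_leq_col (A0 + A1)%MS.
  by move: kK capK; lia.
rewrite -setI_eq0; apply/eqP/setP=> x; rewrite !inE.
by apply/negP => /andP[]; apply: ncap.
Qed.

(** Disjointness lets the domain, a subset of [E0 :|: E1], determine the values as well. *)
Lemma card_pfun_levels n (E0 E1 : {set {ffun 'I_n -> bool}}) :
  [disjoint E0 & E1] ->
  (#|[set f : pfun n | (level f false \subset E0) && (level f true \subset E1)]|
     <= 2 ^ (#|E0| + #|E1|))%N.
Proof.
move=> dis; have card_U : (#|E0| + #|E1| = #|E0 :|: E1|)%N.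
  by rewrite cardsU (disjoint_setI0 dis) cards0 subn0.
rewrite card_U -card_powerset; set F := [set f | _].
pose dom (f : pfun n) := [set x | f x != None].
have F_E f x b : f \in F -> f x = Some b -> x \in if b then E1 else E0.
  rewrite inE => /andP[/subsetP f0 /subsetP f1] fx.
  by case: b fx => fx; [apply: f1 | apply: f0]; rewrite inE fx.
rewrite -(@card_in_imset _ _ dom F) => [|f g fF gF /setP eq_dom].
  apply/subset_leq_card/subsetP=> _ /imsetP[f fF ->]; rewrite inE.
  apply/subsetP=> x; rewrite !inE; case fx: (f x) => [b|//] _.
  by have := F_E f x b fF fx; case: b {fx} => ->; rewrite ?orbT.
apply/ffunP=> x; have := eq_dom x; rewrite !inE.
case fx: (f x) => [b|]; case gx: (g x) => [c|] // _.
have := F_E f x b fF fx; have := F_E g x c gF gx.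
case: b c {fx gx} => [] [] //= e1 e2.
  by rewrite (disjointFr dis e1) in e2.
by rewrite (disjointFr dis e2) in e1.
Qed.

Lemma card_QE1 n k (S : {set pfun n}) :
  (0 < n)%N ->
  (forall f, f \in S -> depends_on_bits f k /\ QE1 f) ->
  (#|S| <= 2 ^ (2 ^ (n - 1) + 2 ^ (n + 1 - k) + 2 * n ^ 2))%N.
Proof.
move=> n_gt0 SP; set M := (2 ^ (n - 1) + 2 ^ (n + 1 - k))%N.
pose code := {ffun 'I_n -> {ffun 'I_n -> bool}}.
pose E (u : code) := signs_in (tuple_mx u).
pose good (p : code * code) :=
  [disjoint E p.1 & E p.2] && (#|E p.1| + #|E p.2| <= M)%N.
pose F (p : code * code) :=
  [set f : pfun n | (level f false \subset E p.1) && (level f true \subset E p.2)].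
have sub_S : S \subset \bigcup_(p | good p) F p.
  apply/subsetP=> f /SP[fk fQ]; have [kn r0 r1 r01 dis] := QE1_spans _ _ _ fk fQ.
  have [[x0 [x1 [fx0 fx1]]] _] := fQ.
  have lev b x : f x = Some b -> level f b != set0.
    by move=> fx; apply/set0Pn; exists x; rewrite inE fx.
  have [u eq_u] := set_mx_tuple _ _ _ (lev _ _ fx0) r0.
  have [v eq_v] := set_mx_tuple _ _ _ (lev _ _ fx1) r1.
  have Eu : E u = signs_in (set_mx (level f false)).
    by apply/setP=> x; rewrite !inE eq_u.
  have Ev : E v = signs_in (set_mx (level f true)).
    by apply/setP=> x; rewrite !inE eq_v.
  have sub b : level f b \subset signs_in (set_mx (level f b)).
    by apply/subsetP=> x xf; rewrite inE sign_row_set_mx.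
  apply/bigcupP; exists (u, v); last by rewrite inE /= Eu Ev !sub.
  rewrite /good /= Eu Ev dis /= /M.
  have := card_signs_in _ _ (set_mx (level f false)).
  have := card_signs_in _ _ (set_mx (level f true)).
  (* With [s = 2 * n.+1 - k] bounding the sum of the ranks, this [c] makes [s - c = n], the bound on
     each rank. [card_signs_in] then halves both powers. *)
  have := expn_add_leq_spread (\rank (set_mx (level f false)))
            (\rank (set_mx (level f true))) (n + 2 - k) (2 * n.+1 - k).
  have -> : (2 * n.+1 - k - (n + 2 - k) = (n - 1).+1)%N by lia.
  have e2 : (n + 2 - k = (n + 1 - k).+1)%N by lia.
  rewrite {2}e2 !expnS; move: r0 r1 r01 n_gt0 kn.
  set a := \rank _; set b := \rank _ => r0 r1 r01 n_gt0 kn spread c1 c0.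
  have ha : (a <= (n - 1).+1)%N by lia.
  have hb : (b <= (n - 1).+1)%N by lia.
  have hc : (n + 2 - k <= 2 * n.+1 - k)%N by lia.
  have hs : (a + b <= 2 * n.+1 - k)%N by lia.
  rewrite -(@leq_pmul2l 2) // !mulnDr.
  exact: leq_trans (leq_add c0 c1) (spread ha hb hc hs).
apply: leq_trans (subset_leq_card sub_S) _.
have le_sum : (#|\bigcup_(p | good p) F p| <= \sum_(p | good p) 2 ^ M)%N.
  elim/big_rec2: _ => [|p m B /andP[dis le_M] IH]; first by rewrite cards0.
  apply: leq_trans (leq_card_setU _ _) (leq_add _ IH).
  by apply: leq_trans (card_pfun_levels _ _ _ dis) _; rewrite leq_pexp2l.
apply: leq_trans le_sum _; rewrite sum_nat_const expnD mulnC leq_mul2l.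
apply/orP; right; apply: leq_trans (max_card _) _.
(* Each of the two codes consists of [n] inputs of [n] bits, hence [2 ^ (2 * n ^ 2)] pairs. *)
rewrite card_prod !card_ffun !card_bool !card_ord -!expnM -expnD.
by rewrite -mulnn mul2n addnn.
Qed.

(* N_1(n,k) <= bound, stated as: every set of n-bit partial functions that
   depend on k bits and have QE = 1 has at most that many elements. *)
Theorem theorem5 (n k : nat) :
  (3 <= n)%N -> (2 <= k)%N ->
  forall S : {set pfun n},
    (forall f, f \in S -> depends_on_bits f k /\ QE1 f) ->
    (#|S|%:R : RR) <=
      (n ^ 2)%:R * Rpow 2 ((2 ^ (n - 1))%:R * (1 + Rpow 2 (2 - k%:R))
                             + 2 * (n ^ 2)%:R).
Proof.
move=> n_ge3 k_ge2 S SP; have n_gt0 : (0 < n)%N by lia.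
(* A member of [S] supplies [k <= n], so that the real exponent [(n - 1) + (2 - k)] equals the
   natural number [n + 1 - k]. *)
have [->|/set0Pn[f fS]] := eqVneq S set0.
  rewrite cards0 mulr_ge0 ?ler0n //.
  by apply/RleP/RIneq.Rlt_le; apply: Exp_prop.exp_pos.
have [fk fQ] := SP f fS; have [k_le_n _ _ _ _] := QE1_spans _ _ _ fk fQ.
have Rpow2 m : Rpow 2 m%:R = (2 ^ m)%:R.
  rewrite -(INRE m) Rpower.Rpower_pow; last by apply/RltP; rewrite ltr0n.
  by rewrite RpowE natrX.
have -> : (2 ^ (n - 1))%:R * (1 + Rpow 2 (2 - k%:R)) + 2 * (n ^ 2)%:R
    = (2 ^ (n - 1) + 2 ^ (n + 1 - k) + 2 * n ^ 2)%:R :> RR.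
  rewrite mulrDr mulr1 [RHS]natrD (natrD _ (2 ^ (n - 1))) [X in _ = _ + X]natrM.
  congr (_ + _ + _).
  rewrite -!Rpow2 -RmultE -Rpower.Rpower_plus RplusE; congr (Rpow _ _).
  rewrite addrA -natrD -natrB; last by lia.
  by congr (_%:R); lia.
rewrite Rpow2 -natrM ler_nat.
apply: leq_trans (card_QE1 _ _ _ n_gt0 SP) _.
by rewrite leq_pmull // expn_gt0 n_gt0.
Qed.
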